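(* Let $G$ be a scalable group. Then $\mathrm{DP}(G)\leq_m 3\text{-}\mathrm{SAT}(G)$.
   Context: A finitely generated group $G$ is scalable if there exists a proper finite index subgroup $H\lneq G$ that is isomorphic to $G$. Let $S$ be a finite generating set of $G$; a word $w\in(S\cup S^{-1})^*$ evaluates to an element $\bar w\in G$. Domino problem: for a finite alphabet $A$, a nearest neighbor pattern is a tuple $(a,b,s)$ with $a,b\in A$, $s\in S$; it appears in $x\in A^G$ if there is $g\in G$ with $x(g)=a$ and $x(gs)=b$. For a finite set $\mathcal F$ of such patterns, $X_{\mathcal F}\subseteq A^G$ is the set of configurations in which no pattern of $\mathcal F$ appears. $\mathrm{DP}(G,S)$: given $A$ and $\mathcal F$, determine whether $X_{\mathcal F}$ is non-empty (yes instances are those with $X_{\mathcal F}\ne\emptyset$). It is known that $\mathrm{DP}(G,S_1)$ and $\mathrm{DP}(G,S_2)$ are many-one equivalent for all finite generating sets $S_1,S_2$, so one writes $\mathrm{DP}(G)$. $k$-SAT over $G$ ($k>1$): Boolean variables are the elements of $G$; for $g\in G$, $g'$ denotes either the literal $g$ or its negation $\neg g$. An input formula is $\phi=\bigwedge_{i=1}^m (v_{i1}'\vee\dots\vee v_{ik}')$ with $v_{ij}\in (S\cup S^{-1})^*$, where each $'$ indicates a fixed choice of negated or non-negated; its evaluation is $\bar\phi=\bigwedge_{i=1}^m (\bar v_{i1}'\vee\dots\vee \bar v_{ik}')$. For $h\in G$, $\bar\phi(h)$ is obtained from $\bar\phi$ by left-multiplying every variable by $h$ (with the same negations). The problem $k\text{-}\mathrm{SAT}(G)$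 is: given an input formula $\phi$ and words $w_1,\dots,w_n\in(S\cup S^{-1})^*$, determine whether $\bigwedge_{h\in H}\bar\phi(h)$ is satisfiable, where $H=\langle \bar w_1,\dots,\bar w_n\rangle$; that is, whether there is an assignment $\alpha:G\to\{0,1\}$ making every clause of $\bar\phi(h)$ true for every $h\in H$. (The choice of $S$ is immaterial, since inputs can be computably rewritten in another generating set.) $L\leq_m L'$ (many-one reduction) means there is a computable function $f$ with $w\in L\iff f(w)\in L'$ for every $w$; problems are identified with their languages of yes instances. *)

(* Defs.v *)
From HB Require Import structures.
From mathcomp Require Import finmap all_boot.
From mathcomp Require Import boolp classical_sets functions cardinality.

Set Implicit Arguments.
Unset Strict Implicit.
Unset Printing Implicit Defensive.

Local Open Scope classical_set_scope.
Local Open Scope group_scope.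

(* Kleene's partial recursive functions: [recf n] is the syntax of n-ary
   functions, and [run p v y] says that p is defined at v with value y. *)
Inductive recf : nat -> Type :=
| RZero n : recf n
| RSucc : recf 1
| RProj n (i : 'I_n) : recf n
| RComp m n (f : recf m) (g : 'I_m -> recf n) : recf n
| RRec n (f : recf n) (g : recf n.+2) : recf n.+1
| RMin n (f : recf n.+1) : recf n.

Fixpoint run n (p : recf n) : n.-tuple nat -> nat -> Prop :=
  match p in recf n return n.-tuple nat -> nat -> Prop with
  | RZero _ => fun _ y => y = 0%N
  | RSucc => fun v y => y = (thead v).+1
  | RProj _ i => fun v y => y = tnth v i
  | RComp m _ f g => fun v y =>
      exists2 u : m.-tuple nat,
        forall i : 'I_m, run (g i) v (tnth u i) & run f u y
  | RRec _ f g => fun v y =>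
      (* t is the table of the values at 0, ..., thead v. *)
      exists t : nat -> nat,
        [/\ run f [tuple of behead v] (t 0%N),
            forall i, (i < thead v)%N ->
              run g [tuple of i :: t i :: [tuple of behead v]] (t i.+1)
          & y = t (thead v)]
  | RMin _ f => fun v y =>
      run f [tuple of y :: v] 0%N /\
      forall i, (i < y)%N -> exists z, run f [tuple of i :: v] z.+1
  end.

(* Inputs and outputs are coded by the library's [pickle]. On the types of
   instances below it is effective: pairs and sequences are coded by
   [CodeSeq.code], i.e. nil by 0 and x :: s by 2 ^ x * (2 * s + 1), an ordinal
   by its value, and an element of a fixed finite set by its index. *)
Definition computable (X Y : countType) (f : X -> Y) : Prop :=
  exists p : recf 1, forall x : X, run p [tuple pickle x] (pickle (f x)).

(* A decision problem is the predicate of its yes instances. *)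
Definition many_one (X Y : countType) (P : X -> Prop) (Q : Y -> Prop) : Prop :=
  exists2 f : X -> Y, computable f & forall x, P x <-> Q (f x).

Section Groups.
Variable G : groupType.

Definition is_subgroup (H : set G) : Prop :=
  [/\ H 1, forall x y, H x -> H y -> H (x * y) & forall x, H x -> H x^-1].

Definition subgroup_gen (X : set G) : set G := smallest is_subgroup X.

Definition generates (S : {fset G}) : Prop :=
  subgroup_gen [set g | g \in S] = setT.

Definition left_coset (H : set G) (g : G) : set G := [set g * h | h in H].

Definition finite_index (H : set G) : Prop :=
  finite_set (range (left_coset H)).

Definition isomorphic_to_whole (H : set G) : Prop :=
  exists f : {multiplicative G -> G}, set_bij [set: G] H f.

Definition scalable : Prop :=
  (exists S : {fset G}, generates S) /\
  exists H : set G,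
    [/\ is_subgroup H, H <> setT, finite_index H & isomorphic_to_whole H].

Section Problems.
Variable S : {fset G}.

(* The letter (b, s) stands for s if b = true, and for s^-1 if b = false. *)
Definition word : Type := seq (bool * S).
HB.instance Definition _ := Countable.on word.

Definition eval_letter (l : bool * S) : G :=
  if l.1 then val l.2 else (val l.2)^-1.

Definition eval_word (w : word) : G := \prod_(l <- w) eval_letter l.

Definition pattern (n : nat) : Type := ('I_n * 'I_n * S)%type.
HB.instance Definition _ n := Countable.on (pattern n).

Definition appears n (p : pattern n) (x : G -> 'I_n) : Prop :=
  let: (a, b, s) := p in exists g, x g = a /\ x (g * val s) = b.

(* The alphabet is 'I_n. *)
Definition dp_instance : Type := {n : nat & seq (pattern n)}.
HB.instance Definition _ := Countable.on dp_instance.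

Definition DP (I : dp_instance) : Prop :=
  exists x : G -> 'I_(tag I), forall p, p \in tagged I -> ~ appears p x.

(* The literal (b, w) is the variable w if b = true, and its negation if
   b = false. *)
Definition literal : Type := (bool * word)%type.
HB.instance Definition _ := Countable.on literal.

Definition formula (k : nat) : Type := seq (k.-tuple literal).
HB.instance Definition _ k := Countable.on (formula k).

Definition literal_true (alpha : G -> bool) (h : G) (l : literal) : bool :=
  alpha (h * eval_word l.2) == l.1.

(* Every clause of phi, evaluated in G and left-multiplied by h, is true. *)
Definition satisfies_at k (alpha : G -> bool) (phi : formula k) (h : G) : bool :=
  all (fun c : k.-tuple literal => has (literal_true alpha h) c) phi.

Definition sat_instance (k : nat) : Type := (formula k * seq word)%type.
HB.instance Definition _ k := Countable.on (sat_instance k).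

Definition kSAT k (I : sat_instance k) : Prop :=
  exists alpha : G -> bool,
    forall h, subgroup_gen [set eval_word w | w in [set` I.2]] h ->
      satisfies_at alpha I.1 h.

End Problems.
End Groups.

(* Main.v *)
(* Let f be an isomorphism of G onto a proper subgroup and t outside of its
   image. For i < k, the elements f^i(t) lie in distinct right cosets of f^k(G),
   so the elements f^k(g) f^i(t) give k independent boolean variables for each
   cell g. For n colors, take k = 2n + 1: the variable v_j says that the cell has
   color j, and u_j that its color is less than j. The clauses u_n, ~ u_0 and
   u_{j+1} -> u_j \/ v_j force some v_j, and each forbidden pattern is a clause
   with two literals. The words spelling f^k(g) are obtained by iterating k times
   a substitution on the letters, which is primitive recursive. *)
Require Import Defs.
From mathcomp Require Import finmap all_boot.
From mathcomp Require Import boolp classical_sets functions.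

Set Implicit Arguments.
Unset Strict Implicit.
Unset Printing Implicit Defensive.

(** * Closure properties of recursive functions *)

(* [v] and [y] give the inputs and the output as functions of [x : X], so that
   [p] need only be defined on the range of [v]. *)
Definition computed (X : Type) n (v : X -> n.-tuple nat) (y : X -> nat) :=
  exists p : recf n, forall x, run p (v x) (y x).

(** The map [h] into [X] needs no program of its own: only the numerical coordinates of [w (h z)]
    do, so [X] may be any type of structured data. *)
Lemma computed_comp X Z m n (w : X -> m.-tuple nat) (y : X -> nat)
    (v : Z -> n.-tuple nat) (h : Z -> X) :
  computed w y -> (forall i, computed v (fun z => tnth (w (h z)) i)) ->
  computed v (fun z => y (h z)).
Proof.
move=> [p py] /fin_all_exists[q qw].
by exists (RComp p q) => z; exists (w (h z)); last exact: py.
Qed.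

Lemma computed_nth X n (v : X -> n.-tuple nat) i :
  i < n -> computed v (fun x => nth 0 (v x) i).
Proof.
by move=> ltin; exists (RProj (Ordinal ltin)) => x /=; rewrite (tnth_nth 0).
Qed.

Definition computed1 (F : nat -> nat) := computed (fun x => [tuple x]) F.

Definition computed2 (F : nat -> nat -> nat) :=
  computed (fun q => [tuple q.1; q.2]) (fun q => F q.1 q.2).

Lemma computed_comp1 X n (v : X -> n.-tuple nat) F y :
  computed1 F -> computed v y -> computed v (fun x => F (y x)).
Proof.
move=> cF cy; apply: (computed_comp (h := y) cF) => i.
by case: cy => p py; exists p => x; rewrite ord1 tnth0.
Qed.

Lemma computed_comp_pair X Z n (w1 w2 y : X -> nat) (v : Z -> n.-tuple nat)
    (h : Z -> X) :
  computed (fun x => [tuple w1 x; w2 x]) y ->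
  computed v (fun z => w1 (h z)) -> computed v (fun z => w2 (h z)) ->
  computed v (fun z => y (h z)).
Proof.
move=> cy c1 c2; apply: (computed_comp (h := h) cy) => i.
(* Reading ['I_2] as ['I_(1 + 1)] splits the index into two cases, each over a one-element type. *)
by case: (fintype.split (i : 'I_(1 + 1))) (splitK (i : 'I_(1 + 1))) => j <-;
  rewrite ord1; [case: c1 | case: c2] => p py; exists p.
Qed.

Lemma computed_comp2 X n (v : X -> n.-tuple nat) F y1 y2 :
  computed2 F -> computed v y1 -> computed v y2 ->
  computed v (fun x => F (y1 x) (y2 x)).
Proof.
move=> cF c1 c2.
exact: (computed_comp_pair (h := fun x => (y1 x, y2 x)) cF c1 c2).
Qed.

(** The step need only be correct at the true earlier values [t q.1 q.2]. When these are codes of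
    data, its program may be undefined at other numbers. *)
Lemma computed_rec X n (v : X -> n.-tuple nat) (t : X -> nat -> nat) :
  computed v (t^~ 0) ->
  computed (fun q : X * nat => [tuple of q.2 :: t q.1 q.2 :: v q.1])
    (fun q => t q.1 q.2.+1) ->
  computed (fun q : X * nat => [tuple of q.2 :: v q.1]) (fun q => t q.1 q.2).
Proof.
move=> [p pt] [q qt]; exists (RRec p q) => -[x i] /=; exists (t x).
have behead_v j : [tuple of behead [tuple of j :: v x]] = v x by apply: val_inj.
split=> [|j _|//]; first by rewrite behead_v.
by have := qt (x, j); congr run; apply: val_inj.
Qed.

Lemma computed_const X n (v : X -> n.-tuple nat) c : computed v (fun=> c).
Proof.
elim: c => [|c IHc]; first by exists (RZero n).
by apply: (computed_comp1 (F := S)) IHc; exists RSucc.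
Qed.

Lemma computed1_rec (F : nat -> nat) (g : nat -> nat -> nat) :
  computed2 g -> (forall i, F i.+1 = g i (F i)) -> computed1 F.
Proof.
move=> cg FS.
have := @computed_rec unit 0 (fun=> [tuple]) (fun=> F) (computed_const _ _).
case=> [|p pF]; last first.
  by exists p => i; have := pF (tt, i); congr run; apply: val_inj.
have [p pg] := cg; exists p => -[u i] /=; rewrite FS.
by have := pg (i, F i); congr run; apply: val_inj.
Qed.

Lemma computed2_rec (F : nat -> nat -> nat) (g : nat -> nat -> nat) :
  computed1 (F 0) -> computed2 g -> (forall i x, F i.+1 x = g (F i x) x) ->
  computed2 F.
Proof.
move=> c0 cg FS.
have := @computed_rec nat 1 (fun x => [tuple x]) (fun x i => F i x) c0.
case=> [|p pF]; last first.
  by exists p => -[i x]; have := pF (x, i); congr run; apply: val_inj.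
pose v (q : nat * nat) := [tuple of q.2 :: F q.2 q.1 :: [tuple q.1]].
have := computed_comp2 cg (@computed_nth _ _ v 1 isT)
  (@computed_nth _ _ v 2 isT).
by case=> p pg; exists p => q; rewrite FS; apply: pg.
Qed.

Lemma computed1_id : computed1 id.
Proof. exact: (@computed_nth _ _ (fun x => [tuple x]) 0). Qed.

Lemma computed2_fst : computed2 (fun x _ => x).
Proof.
exact: (@computed_nth _ _ (fun q : nat * nat => [tuple q.1; q.2]) 0).
Qed.

Lemma computed2_snd : computed2 (fun _ y => y).
Proof.
exact: (@computed_nth _ _ (fun q : nat * nat => [tuple q.1; q.2]) 1).
Qed.

Lemma computed1_succ : computed1 S.
Proof. by exists RSucc. Qed.

Lemma computed1_table l : computed1 (nth 0 l).
Proof.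
elim: l => [|b l IHl].
  by apply: (computed1_rec computed2_snd) => i; rewrite !nth_nil.
by apply: (computed1_rec (g := fun i _ => nth 0 l i)) => //;
  apply: computed_comp1 IHl computed2_fst.
Qed.

Lemma computed2_iter F : computed1 F -> computed2 (fun i x => iter i F x).
Proof.
move=> cF; apply: (computed2_rec computed1_id (g := fun y _ => F y)) => //.
exact: computed_comp1 cF computed2_fst.
Qed.

Lemma computed2_add : computed2 addn.
Proof.
apply: (computed2_rec computed1_id (g := fun y _ => y.+1)) => //.
exact: computed_comp1 computed1_succ computed2_fst.
Qed.

Lemma computed1_double : computed1 double.
Proof.
apply: (@computed1_rec _ (fun _ y => y.+2)) => //.
apply: computed_comp1 computed1_succ _.
exact: computed_comp1 computed1_succ computed2_snd.
Qed.

Lemma computed1_odd : computed1 odd.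
Proof.
(* Lookup in [[:: 1]] sends 0 to 1 and anything larger to 0, so it negates a bit. *)
apply: (@computed1_rec _ (fun _ y => nth 0 [:: 1] y)) => [|i].
  exact: computed_comp1 (computed1_table _) computed2_snd.
by rewrite oddS; case: (odd i).
Qed.

Lemma computed1_half : computed1 half.
Proof.
apply: (@computed1_rec _ (fun i y => odd i + y)) => [|i].
  apply: computed_comp2 computed2_add _ computed2_snd.
  exact: computed_comp1 computed1_odd computed2_fst.
by rewrite -[_./2]/(uphalf i) uphalf_half.
Qed.

(** * Arithmetic of list and pair codes *)

(* Cons, head and tail on [CodeSeq.code], where [a :: s] is coded by
   [2 ^ a * (2 * s + 1)]: the head is the number of halvings before an odd
   number is reached, which the code itself bounds. *)
Definition code_cons a c := iter a double c.*2.+1.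
Definition code_head c := iter c (fun m => m + ~~ odd (iter m half c)) 0.
Definition code_tail c := (iter (code_head c) half c)./2.

Lemma computed2_cons : computed2 code_cons.
Proof.
apply: computed_comp2 (computed2_iter computed1_double) computed2_fst _.
apply: computed_comp1 computed1_succ _.
exact: computed_comp1 computed1_double computed2_snd.
Qed.

Lemma computed1_head : computed1 code_head.
Proof.
(* In [code_head] the loop bound and the number examined coincide; recursion on the bound requires
   two separate arguments. *)
pose F i c := iter i (fun m => m + ~~ odd (iter m half c)) 0.
suff cF: computed2 F by apply: computed_comp2 cF computed1_id computed1_id.
pose g m c := m + nth 0 [:: 1] (odd (iter m half c)).
apply: (@computed2_rec F g) => [||i x]; first exact: computed_const.
  apply: computed_comp2 computed2_add computed2_fst _.
  apply: computed_comp1 (computed1_table _) _.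
  apply: computed_comp1 computed1_odd _; exact: computed2_iter computed1_half.
by rewrite /F /= /g; case: odd.
Qed.

Lemma computed1_tail : computed1 code_tail.
Proof.
apply: computed_comp1 computed1_half _.
apply: computed_comp2 (computed2_iter computed1_half) _ computed1_id.
exact: computed1_head.
Qed.

Lemma code_consE a c : code_cons a c = 2 ^ a * c.*2.+1.
Proof.
rewrite /code_cons; elim: a => [|a IHa]; first by rewrite mul1n.
by rewrite iterS IHa expnS -mulnA mul2n.
Qed.

Lemma iter_half_code m a c : m <= a ->
  iter m half (code_cons a c) = code_cons (a - m) c.
Proof.
elim: m => [|m IHm] ltma; first by rewrite subn0.
rewrite iterS IHm 1?ltnW // -(subnSK ltma) /code_cons iterS.
by rewrite doubleK.
Qed.

Lemma code_head_cons a c : code_head (code_cons a c) = a.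
Proof.
have ltac: a < code_cons a c.
  by rewrite code_consE; apply: leq_trans (ltn_expl a _) (leq_pmulr _ _).
(* Loop invariant: after [i] rounds the counter is [minn i a]. The bound [a < code_cons a c] makes
   the final value [a]. *)
rewrite /code_head -[RHS](minn_idPr (ltnW ltac)).
elim: {1 3}(code_cons _ _) => [|i IHi]; first by rewrite min0n.
rewrite iterS {}IHi iter_half_code ?geq_minr //.
have [leai|ltia] := leqP a i.
  by rewrite (minn_idPr (leqW leai)) subnn /= odd_double addn0.
by rewrite (minn_idPl ltia) -(subnSK ltia) /code_cons iterS odd_double addn1.
Qed.

Lemma code_tail_cons a c : code_tail (code_cons a c) = c.
Proof.
by rewrite /code_tail code_head_cons iter_half_code // subnn /= uphalf_double.
Qed.

Lemma pickle_cons (A : countType) (a : A) s :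
  pickle (a :: s) = code_cons (pickle a) (pickle s).
Proof. by rewrite code_consE. Qed.

(** A pair is coded like a list of length two, whence the closing [0]. *)
Lemma pickle_pair (A B : countType) (q : A * B) :
  pickle q = code_cons (pickle q.1) (code_cons (pickle q.2) 0).
Proof. by case: q => a b; rewrite !code_consE. Qed.

(** * Computable functions on coded data *)

Lemma computable_code (X Y : countType) (f : X -> Y) F :
  computed1 F -> (forall x, pickle (f x) = F (pickle x)) -> computable f.
Proof. by move=> [p pF] fE; exists p => x; rewrite fE. Qed.

Lemma computable_comp (X Y Z : countType) (f : Y -> Z) (g : X -> Y) :
  computable f -> computable g -> computable (fun x => f (g x)).
Proof.
move=> cf [p pg]; apply: (computed_comp (h := g) cf) => i.
by exists p => x; rewrite ord1 tnth0.
Qed.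

Lemma computable_id (X : countType) : computable (@id X).
Proof. exact: computable_code computed1_id _. Qed.

Lemma computable_const (X Y : countType) (y : Y) : computable (fun _ : X => y).
Proof. exact: computed_const. Qed.

Lemma computable_fst (X Y : countType) : computable (@fst X Y).
Proof.
apply: computable_code computed1_head _ => q.
by rewrite pickle_pair code_head_cons.
Qed.

Lemma computable_snd (X Y : countType) : computable (@snd X Y).
Proof.
apply: computable_code (computed_comp1 computed1_head computed1_tail) _ => q.
by rewrite pickle_pair code_tail_cons code_head_cons.
Qed.

Lemma computable_fst_of (X Y Z : countType) (f : X -> Y * Z) :
  computable f -> computable (fun x => (f x).1).
Proof. exact/computable_comp/computable_fst. Qed.

Lemma computable_snd_of (X Y Z : countType) (f : X -> Y * Z) :
  computable f -> computable (fun x => (f x).2).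
Proof. exact/computable_comp/computable_snd. Qed.

Lemma computable_snd_fst (X Y Z : countType) :
  computable (fun q : X * (Y * Z) => q.2.1).
Proof. by apply: computable_fst_of; apply: computable_snd. Qed.

Lemma computable_snd_snd (X Y Z : countType) :
  computable (fun q : X * (Y * Z) => q.2.2).
Proof. by apply: computable_snd_of; apply: computable_snd. Qed.

Lemma computable_cons (X A : countType) (a : X -> A) (s : X -> seq A) :
  computable a -> computable s -> computable (fun x => a x :: s x).
Proof.
move=> ca cs; have [p pE] := computed_comp2 computed2_cons ca cs.
by exists p => x; rewrite pickle_cons.
Qed.

Lemma computable_pair (X Y Z : countType) (f : X -> Y) (g : X -> Z) :
  computable f -> computable g -> computable (fun x => (f x, g x)).
Proof.
move=> cf cg; have cg0 := computed_comp2 computed2_cons cg (computed_const _ 0).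
have [p pE] := computed_comp2 computed2_cons cf cg0.
by exists p => x; rewrite pickle_pair.
Qed.

(** The codes of a finite type are bounded, so a finite table suffices; its entries at numbers that
    code nothing are set to 0. *)
Lemma computable_fin (F : finType) (Y : countType) (f : F -> Y) : computable f.
Proof.
pose value c := oapp (fun x => pickle (f x)) 0 (unpickle c).
pose N := (\max_(x : F) pickle x).+1.
apply: computable_code (computed1_table (mkseq value N)) _ => x.
by rewrite nth_mkseq ?ltnS ?(leq_bigmax x) // /value pickleK.
Qed.

Lemma computable_rec (X Z Y : countType) (h : X -> nat -> Y)
    (g : X * (nat * Y) -> Y) (x : Z -> X) (n : Z -> nat) :
  computable (h^~ 0) -> computable g ->
  (forall x i, h x i.+1 = g (x, (i, h x i))) ->
  computable x -> computable n -> computable (fun z => h (x z) (n z)).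
Proof.
move=> c0 [pg gP] hS cx cn.
pose v (x : X) := [tuple pickle x]; pose t x i := pickle (h x i).
pose w (q : X * nat) := [tuple of q.2 :: t q.1 q.2 :: v q.1].
have cstep : computed w (fun q => t q.1 q.2.+1).
  pose arg (q : X * nat) := (q.1, (q.2, h q.1 q.2)).
  suff [p pP] : computed w (fun q => pickle (g (arg q))).
    by exists p => q; rewrite /t hS; apply: pP.
  apply: (@computed_comp _ _ _ _ (fun y => [tuple pickle y])
    (fun y => pickle (g y)) w arg) => [|i]; first by exists pg.
  pose j k := @computed_nth _ _ w k.
  (* The tuple [w] lists index, previous value and parameter; these are reassembled, from the inside
     out, into the code of [(x, (i, h x i))]. *)
  have c2 := computed_comp2 computed2_cons (j 1 isT) (computed_const _ 0).
  have c3 := computed_comp2 computed2_cons (j 0 isT) c2.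
  have c4 := computed_comp2 computed2_cons c3 (computed_const _ 0).
  have [p pP] := computed_comp2 computed2_cons (j 2 isT) c4.
  exists p => q; have := pP q.
  by rewrite ord1 tnth0 !pickle_pair.
have [p pP] := computed_rec (v := v) (t := t) c0 cstep.
apply: (@computed_comp_pair _ _ _ snd (fun q => pickle q.1)
  (fun q => t q.1 q.2) _ (fun z => (x z, n z))) => //.
by exists p => q; have := pP q; congr run; apply: val_inj.
Qed.

(* The branch for [c x <> 0] is run only when that holds, so that it may be
   undefined elsewhere; it is iterated [c x] times with a constant value. *)
Lemma computed_case X n (c : X -> nat) (v : X -> n.-tuple nat) y0 y :
  computed v y0 ->
  computed (fun x : {x | c x != 0} => v (val x)) (fun x => y (val x)) ->
  (forall x, c x = 0 -> y x = y0 x) ->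
  computed (fun x => [tuple of c x :: v x]) y.
Proof.
move=> [p py0] [q qy] yE.
exists (RRec p (RComp q (fun i => RProj (lift ord0 (lift ord0 i))))) => x /=.
have behead_v : [tuple of behead [tuple of c x :: v x]] = v x by apply: val_inj.
exists (fun i => if i is 0 then y0 x else y x).
split=> [|i lti|]; first by rewrite behead_v.
  have cx : c x != 0 by rewrite -lt0n; apply: leq_trans lti.
  exists (v x) => [k|]; last exact: qy (exist _ x cx).
  by rewrite !(tnth_nth 0).
by rewrite theadE; case cx: (c x) => [|//]; rewrite yE.
Qed.

(** Only the empty list has code 0, so the branch is chosen by testing the code. The cons branch
    first repacks the code of [(x, a :: s)] as that of [(x, (a, s))]. *)
Lemma computable_case (X Z A Y : countType) (h : X -> seq A -> Y)
    (x : Z -> X) (l : Z -> seq A) :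
  computable (h^~ [::]) ->
  computable (fun q : X * (A * seq A) => h q.1 (q.2.1 :: q.2.2)) ->
  computable x -> computable l -> computable (fun z => h (x z) (l z)).
Proof.
move=> c0 [p pP] cx cl.
have cq := computable_pair cx cl.
suff ch : computed (fun q : X * seq A => [tuple pickle q.2; pickle q])
                   (fun q => pickle (h q.1 q.2)).
  exact: (computed_comp_pair (h := fun z => (x z, l z)) ch).
have := @computed_case (X * seq A) 1 (fun q => pickle q.2)
  (fun q => [tuple pickle q])
  (fun q => pickle (h q.1 [::])) (fun q => pickle (h q.1 q.2)).
case=> [||[x' [|a s]] //|r rP]; last 2 first.
- by move/eqP; rewrite pickle_cons code_consE muln_eq0 expn_eq0.
- by exists r => q; have := rP q; congr run; apply: val_inj.
- exact: computable_comp c0 (@computable_fst _ _).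
pose tl2 c := code_head (code_tail c).
have ctl2 : computed1 tl2.
  by apply: computed_comp1 computed1_head computed1_tail.
have c1 := computed_comp2 computed2_cons (computed_comp1 computed1_tail ctl2)
  (computed_const _ 0).
have c2 := computed_comp2 computed2_cons (computed_comp1 computed1_head ctl2)
  c1.
have c3 := computed_comp2 computed2_cons c2 (computed_const _ 0).
have [e eP] := computed_comp2 computed2_cons computed1_head c3.
exists (RComp p (fun=> e)) => -[[x' [|a s]] //= _].
exists [tuple pickle (x', (a, s))]; last exact: pP.
move=> i; have := eP (pickle (x', a :: s)); rewrite ord1 tnth0 /tl2.
rewrite !pickle_pair /= pickle_cons.
by rewrite !(code_tail_cons, code_head_cons).
Qed.

Lemma size_pickle (A : countType) (s : seq A) : size s <= pickle s.
Proof.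
elim: s => //= a s IHs; rewrite pickle_cons code_consE.
apply: leq_trans (leq_pmull _ _); last by rewrite expn_gt0.
by rewrite ltnS (leq_trans IHs) // -addnn leq_addr.
Qed.

(** The fold is run by iterating a step that consumes the head of the list. The code of the list
    bounds its length, and the surplus rounds leave the state unchanged. *)
Lemma computable_foldl (X Z A Y : countType) (g : X -> Y -> A -> Y)
    (x : Z -> X) (y : Z -> Y) (l : Z -> seq A) :
  computable (fun q : X * (Y * A) => g q.1 q.2.1 q.2.2) ->
  computable x -> computable y -> computable l ->
  computable (fun z => foldl (g (x z)) (y z) (l z)).
Proof.
move=> cg cx cy cl.
pose step (x : X) (st : seq A * Y) :=
  if st.1 is a :: s then (s, g x st.2 a) else st.
pose h q i := iter i (step q.1) q.2.
have hE x0 y0 s i : size s <= i -> (h (x0, (s, y0)) i).2 = foldl (g x0) y0 s.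
  rewrite /h /=; elim: i s y0 => [|i IHi] [|a s] y0 //;
    rewrite ?iterSr; last first.
    exact: IHi.
  by move=> _; rewrite -[RHS](IHi [::]).
suff ch : computable (fun z => h (x z, (l z, y z)) (pickle (l z))).
  have [p pP] := computable_snd_of ch.
  by exists p => z; have := pP z; rewrite hE ?size_pickle.
(* The list is moved to the last component, where [computable_case] can inspect it. *)
pose st (q : (X * Y) * seq A) := step q.1.1 (q.2, q.1.2).
have cst : computable st.
  apply: (@computable_case (X * Y)%type _ A _ (fun q s => st (q, s)) fst snd).
  - apply: computable_pair; first exact: computable_const.
    exact: computable_snd.
  - rewrite /st /step /=; apply: computable_pair.
      exact: computable_snd_snd.
    apply: (computable_comp (g := fun q : X * Y * (A * seq A) =>
      (q.1.1, (q.1.2, q.2.1))) cg).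
    by do 2?apply: computable_pair;
      [apply: computable_fst_of | apply: computable_snd_of | ];
      [exact: computable_fst | exact: computable_fst | ];
      exact: computable_snd_fst.
  - exact: computable_fst.
  - exact: computable_snd.
pose gg (q : (X * (seq A * Y)) * (nat * (seq A * Y))) := step q.1.1 q.2.2.
apply: (@computable_rec _ _ _ h gg (fun z => (x z, (l z, y z)))
  (fun z => pickle (l z))).
- by apply: computable_snd.
- have ggE q : gg q = st ((q.1.1, q.2.2.2), q.2.2.1).
    by rewrite /gg /st /=; case: q.2.2.
  rewrite (funext ggE); apply: computable_comp cst _.
  have c2 : computable (fun q : (X * (seq A * Y)) * (nat * (seq A * Y)) =>
      q.2.2).
    exact: computable_snd_snd.
  apply: computable_pair; last exact: computable_fst_of.
  apply: computable_pair; last exact: computable_snd_of.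
  by do 2!apply: computable_fst_of; apply: computable_id.
- by [].
- by do 2?apply: computable_pair.
- by apply: computable_comp cl; apply: computable_code computed1_id _.
Qed.

(** A right fold is a left fold over the reversed list, and reversal is itself a left fold. *)
Lemma computable_foldr (X Z A Y : countType) (g : X -> A -> Y -> Y)
    (x : Z -> X) (y : Z -> Y) (l : Z -> seq A) :
  computable (fun q : X * (A * Y) => g q.1 q.2.1 q.2.2) ->
  computable x -> computable y -> computable l ->
  computable (fun z => foldr (g (x z)) (y z) (l z)).
Proof.
move=> cg cx cy cl.
have revE s : rev s = foldl (fun t (a : A) => a :: t) [::] s.
  by rewrite /rev; elim: s [::] => //=.
have crev : computable (fun z => rev (l z)).
  rewrite (funext (fun z => revE (l z))).
  apply: (@computable_foldl unit _ _ _ (fun _ s a => a :: s) (fun=> tt)) => //.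
  - apply: computable_cons.
      exact: computable_snd_snd.
    exact: computable_snd_fst.
  - exact: computable_const.
  - exact: computable_const.
have := @computable_foldl _ _ _ _ (fun x y a => g x a y) x y
  (fun z => rev (l z)).
move/(_ _ cx cy crev).
case=> [|p pP]; last first.
  by exists p => z; have := pP z; rewrite foldl_rev.
apply: (computable_comp (g := fun q : X * (Y * A) => (q.1, (q.2.2, q.2.1))) cg).
apply: computable_pair; first exact: computable_fst.
apply: computable_pair; first exact: computable_snd_snd.
exact: computable_snd_fst.
Qed.

Lemma computable_cat (X A : countType) (s t : X -> seq A) :
  computable s -> computable t -> computable (fun x => s x ++ t x).
Proof.
move=> cs ct.
have catE (l m : seq A) : l ++ m = foldr cons m l by elim: l => //= a l ->.
have := @computable_foldr unit _ _ _ (fun _ => cons) (fun=> tt) t s.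
case=> //; last by move=> p pP; exists p => x; rewrite catE.
  2: exact: computable_const.
apply: computable_cons; first exact: computable_snd_fst.
exact: computable_snd_snd.
Qed.

Lemma computable_map (X Z A B : countType) (g : X -> A -> B)
    (x : Z -> X) (l : Z -> seq A) :
  computable (fun q : X * A => g q.1 q.2) -> computable x -> computable l ->
  computable (fun z => map (g (x z)) (l z)).
Proof.
move=> cg cx cl.
apply: (@computable_foldr _ _ _ _ (fun x a s => g x a :: s)) => //; last first.
  exact: computable_const.
apply: computable_cons; last exact: computable_snd_snd.
apply: (computable_comp (g := fun q : X * (A * seq B) => (q.1, q.2.1)) cg).
apply: computable_pair; first exact: computable_fst.
exact: computable_snd_fst.
Qed.

Lemma computable_tuple3 (X A : countType) (a b c : X -> A) :
  computable a -> computable b -> computable c ->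
  computable (fun x => [tuple a x; b x; c x]).
Proof.
move=> ca cb cc; have c0 := @computable_const X (seq A) [::].
exact: computable_cons ca (computable_cons cb (computable_cons cc c0)).
Qed.

Lemma computable_flatten (X A : countType) (ss : X -> seq (seq A)) :
  computable ss -> computable (fun x => flatten (ss x)).
Proof.
move=> css.
apply: (@computable_foldr unit _ _ _ (fun _ => cat) (fun=> tt)) => //;
  last 2 first.
- exact: computable_const.
- exact: computable_const.
apply: computable_cat; first exact: computable_snd_fst.
exact: computable_snd_snd.
Qed.

Lemma computable_iter (X Y : countType) (F : Y -> Y) (n : X -> nat)
    (y : X -> Y) :
  computable F -> computable n -> computable y ->
  computable (fun x => iter (n x) F (y x)).
Proof.
move=> cF cn cy.
apply: (@computable_rec Y X Y (fun y i => iter i F y) (fun q => F q.2.2)) => //.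
  exact: computable_id.
apply: computable_comp cF _; exact: computable_snd_snd.
Qed.

Lemma computable_iota (X : countType) (n : X -> nat) :
  computable n -> computable (fun x => iota 0 (n x)).
Proof.
move=> cn.
apply: (@computable_rec unit X _ (fun _ n => iota 0 n)
  (fun q => q.2.2 ++ [:: q.2.1]) (fun=> tt)) => //; last 2 first.
(* The list grows at its right end: [iota 0 i.+1] is [iota 0 i] followed by [i]. *)
- by move=> u i; rewrite -addn1 iotaD.
- exact: computable_const.
- exact: computable_const.
apply: computable_cat; first exact: computable_snd_snd.
apply: computable_cons; last exact: computable_const.
exact: computable_snd_fst.
Qed.

Lemma computable_double (X : countType) (n : X -> nat) :
  computable n -> computable (fun x => (n x).*2).
Proof.
move=> cn; apply: computable_comp cn.
exact: computable_code computed1_double _.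
Qed.

Lemma computable_succ (X : countType) (n : X -> nat) :
  computable n -> computable (fun x => (n x).+1).
Proof.
move=> cn; apply: computable_comp cn.
exact: computable_code computed1_succ _.
Qed.

(** * The reduction *)

Section Reduction.
Variables (G : groupType) (S T : {fset G}).

(** Patterns over different alphabets have different types; erasure puts them all in one countable
    type without changing their codes. *)
Definition erase n (p : pattern S n) : nat * nat * S :=
  (val p.1.1, val p.1.2, p.2).

Lemma pickle_dp_instance (I : dp_instance S) :
  pickle I = code_cons (tag I) (code_cons (pickle (tagged I)) 0).
Proof. by rewrite !code_consE. Qed.

Lemma computable_tag : computable (fun I : dp_instance S => tag I).
Proof.
apply: computable_code computed1_head _ => I.
by rewrite pickle_dp_instance code_head_cons.
Qed.

Lemma computable_tagged :
  computable (fun I : dp_instance S => [seq erase p | p <- tagged I]).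
Proof.
apply: computable_code (computed_comp1 computed1_head computed1_tail) _ => I.
rewrite pickle_dp_instance code_tail_cons code_head_cons.
by rewrite /pickle /= /pickle_seq -map_comp.
Qed.

(* [sub] gives the image of each letter under the embedding of [G] in itself,
   [ws] spells the generators in [S], and [wt] an element outside of
   the image. *)
Variables (sub : bool * T -> seq (bool * T)) (ws : S -> seq (bool * T)).
Variable wt : seq (bool * T).

Definition subst (w : seq (bool * T)) := flatten (map sub w).

Definition rep j := iter j subst wt.

(* The variable at [rep a.*2.+1] says that the current cell has color [a], and
   the one at [rep a.*2] that it has a color less than [a]. *)
Definition color_clause j :=
  [tuple (false, rep j.+1.*2); (true, rep j.*2); (true, rep j.*2.+1)].

(** A literal is repeated to give the clause exactly three entries. *)
Definition unit_clause (b : bool) j :=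
  [tuple (b, rep j); (b, rep j); (b, rep j)].

(** The word [iter k subst (ws s)] spells [f^k(s)], which leads from cell [g] to cell [g s] since
    [f^k(g) f^k(s) = f^k(g s)]. *)
Definition pattern_clause k (p : nat * nat * S) :=
  let: (a, b, s) := p in let w := iter k subst (ws s) ++ rep b.*2.+1 in
  [tuple (false, rep a.*2.+1); (false, w); (false, w)].

(** Even offsets [0], ..., [2n] carry the [n + 1] thresholds, and the odd offsets between them the
    [n] colors. *)
Definition index_of (I : dp_instance S) := (tag I).*2.+1.

(** The subgroup words spell the images of the generators under [f^k]. For the empty alphabet the
    two unit clauses contradict each other, as they should. *)
Definition reduction (I : dp_instance S) : sat_instance T 3 :=
  (unit_clause true (tag I).*2 :: unit_clause false 0 ::
     [seq color_clause j | j <- iota 0 (tag I)] ++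
     [seq pattern_clause (index_of I) p | p <- [seq erase p | p <- tagged I]],
   [seq iter (index_of I) subst [:: (true, l)] | l <- enum {: T}]).

Lemma computable_subst : computable subst.
Proof.
apply: computable_flatten.
apply: (@computable_map unit _ _ _ (fun _ => sub) (fun=> tt)).
- by apply: computable_comp (computable_fin sub) _; apply: computable_snd.
- exact: computable_const.
- exact: computable_id.
Qed.

Lemma computable_rep (X : countType) (j : X -> nat) :
  computable j -> computable (fun x => rep (j x)).
Proof.
move=> cj; apply: (computable_iter (y := fun=> wt) computable_subst cj).
exact: computable_const.
Qed.

Lemma computable_lit (X : countType) (b : bool) (w : X -> seq (bool * T)) :
  computable w -> computable (fun x => (b, w x)).
Proof. by apply: computable_pair; apply: computable_const. Qed.

Lemma computable_reduction : computable reduction.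
Proof.
have cn := computable_tag.
have cunit b (j : dp_instance S -> nat) :
    computable j -> computable (fun I => unit_clause b (j I)).
  move=> cj; apply: computable_tuple3; apply: computable_lit;
    exact: computable_rep.
have ck : computable index_of by apply/computable_succ/computable_double.
apply: computable_pair; last first.
  apply: (@computable_map nat _ _ _
    (fun k l => iter k subst [:: (true, l)])) => //.
    apply: computable_iter computable_subst _ _; first exact: computable_fst.
    apply: computable_cons; last exact: computable_const.
    apply: computable_pair; first exact: computable_const.
    exact: computable_snd.
  exact: computable_const.
apply: computable_cons; first exact/cunit/computable_double.
apply: computable_cons; first exact/cunit/computable_const.
apply: computable_cat.
  apply: (@computable_map unit _ _ _ (fun _ => color_clause) (fun=> tt)).
  - have c2 : computable (fun q : unit * nat => q.2.*2).
      exact/computable_double/computable_snd.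
    apply: computable_tuple3; apply: computable_lit;
      apply: computable_rep => //.
      by do 2!apply: computable_succ.
    exact: computable_succ.
  - exact: computable_const.
  - exact: computable_iota.
apply: (@computable_map nat _ _ _ pattern_clause) => //;
  last exact: computable_tagged.
have cs : computable (fun q : nat * (nat * nat * S) => ws q.2.2).
  apply: computable_comp (computable_fin ws) _.
  by apply: computable_snd_of; apply: computable_snd.
have ca : computable (fun q : nat * (nat * nat * S) => rep q.2.1.1.*2.+1).
  apply/computable_rep/computable_succ/computable_double.
  by do 2!apply: computable_fst_of; apply: computable_snd.
have cb : computable (fun q : nat * (nat * nat * S) => rep q.2.1.2.*2.+1).
  apply/computable_rep/computable_succ/computable_double.
  by apply: computable_snd_of; apply: computable_fst_of; apply: computable_snd.
have cw := computable_cat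
  (computable_iter computable_subst (@computable_fst _ _) cs) cb.
have := computable_tuple3 (computable_lit false ca) (computable_lit false cw)
  (computable_lit false cw).
by congr computable; apply/funext => -[k [[a b] s]].
Qed.

End Reduction.

(** * Correctness *)

Section GroupEmbedding.
Variables (G : groupType) (T : {fset G}).

Lemma eval_word_nil : @eval_word G T [::] = 1%g.
Proof. by rewrite /eval_word big_nil. Qed.

Lemma eval_word_cat (w1 w2 : word T) :
  eval_word (w1 ++ w2) = (eval_word w1 * eval_word w2)%g.
Proof. by rewrite /eval_word big_cat. Qed.

Lemma eval_word1 (l : bool * T) : @eval_word G T [:: l] = eval_letter l.
Proof. by rewrite /eval_word big_seq1. Qed.

Lemma subgroup_genP (X : set G) : is_subgroup (subgroup_gen X).
Proof.
split=> [A [[]]//|x y Hx Hy A HA|x Hx A HA].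
  by case: (HA) => -[_ AM _] _; apply: AM; [apply: Hx | apply: Hy].
by case: (HA) => -[_ _ AV] _; apply: AV; apply: Hx.
Qed.

Lemma sub_subgroup_gen (X : set G) : (X `<=` subgroup_gen X)%classic.
Proof. by move=> x Xx A [_]; apply. Qed.

Lemma subgroup_gen_min (X A : set G) :
  is_subgroup A -> (X `<=` A)%classic -> (subgroup_gen X `<=` A)%classic.
Proof. by move=> sA XA x; apply. Qed.

Lemma subgroup_of_generates (A : set G) :
  generates T -> is_subgroup A -> (forall g, g \in T -> A g) -> forall g, A g.
Proof.
move=> genT sA TA g; have : subgroup_gen [set` T]%classic g by rewrite genT.
exact: subgroup_gen_min.
Qed.

Lemma generates_word :
  generates T -> forall g, exists w : word T, eval_word w = g.
Proof.
move=> genT; apply: subgroup_of_generates => // [|g gT]; last first.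
  by exists [:: (true, [` gT]%fset)]; rewrite eval_word1.
split=> [|_ _ [w1 <-] [w2 <-]|_ [w <-]].
- by exists [::]; rewrite eval_word_nil.
- by exists (w1 ++ w2); rewrite eval_word_cat.
- elim: w => [|[b l] w [w' w'E]].
    by exists [::]; rewrite eval_word_nil invg1.
  (* The inverse of a word reverses it and flips the sign of each letter. *)
  exists (w' ++ [:: (~~ b, l)]).
  rewrite eval_word_cat w'E -[(b, l) :: w]cat1s eval_word_cat !eval_word1 invgM.
  by rewrite /eval_letter; case: b => //=; rewrite invgK.
Qed.

(** * Iterates of the embedding and cosets of their images *)

Variables (f : G -> G) (t : G).
Hypothesis fM : {morph f : x y / (x * y)%g}.
Hypotheses (f_inj : injective f) (t_notin : forall g, f g <> t).

Lemma iter_mulg k : {morph iter k f : x y / (x * y)%g}.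
Proof. by elim: k => // k IHk x y; rewrite !iterS IHk fM. Qed.

Lemma iter_mulg1 k : iter k f 1%g = 1%g.
Proof. by apply: (mulgI (iter k f 1%g)); rewrite -iter_mulg !mulg1. Qed.

Lemma iter_invg k : {morph iter k f : x / (x^-1)%g}.
Proof.
move=> x; apply: (mulgI (iter k f x)).
by rewrite -iter_mulg !mulgV iter_mulg1.
Qed.

Lemma iter_inj k : injective (iter k f).
Proof. by elim: k => // k IHk x y /f_inj/IHk. Qed.

(** Copies of [f] are peeled off by injectivity until one exponent of [t] is 0. If the other were
    still positive, [t] would lie in the image of [f]. *)
Lemma coset_rep_inj k i j g g' : i < k -> j < k ->
  (iter k f g * iter i f t)%g = (iter k f g' * iter j f t)%g -> i = j /\ g = g'.
Proof.
move=> ltik ltjk E.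
have eq_ij : i = j.
  elim: k i j ltik ltjk E => // k IHk [|i] [|j] //= ltik ltjk.
  - rewrite -fM => /(canRL (mulKg _)).
    rewrite -[(f _)^-1%g](iter_invg 1) -fM => tE.
    by case: (t_notin (esym tE)).
  - rewrite -fM => /esym /(canRL (mulKg _)).
    rewrite -[(f _)^-1%g](iter_invg 1) -fM => tE.
    by case: (t_notin (esym tE)).
  - by rewrite -!fM => /f_inj /IHk ->.
by split=> //; move: E; rewrite eq_ij => /mulIg /iter_inj.
Qed.

(** * Semantics of the words and clauses of the reduction *)

Variables (S : {fset G}) (sub : bool * T -> seq (bool * T)).
Variables (ws : S -> seq (bool * T)) (wt : seq (bool * T)).
Hypotheses (genT : generates T)
  (subE : forall l, eval_word (sub l : word T) = f (eval_letter l))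
  (wsE : forall s, eval_word (ws s : word T) = val s)
  (wtE : eval_word (wt : word T) = t).

Lemma eval_subst k (w : word T) :
  eval_word (iter k (subst sub) w : word T) = iter k f (eval_word w).
Proof.
elim: k => // k IHk; rewrite !iterS -IHk; elim: (iter k _ w) => [|l v IHv].
  by rewrite eval_word_nil -[RHS]/(iter 1 f 1%g) iter_mulg1.
rewrite -[in RHS]cat1s eval_word_cat eval_word1 fM -subE -IHv.
by rewrite -eval_word_cat.
Qed.

Lemma reduction_subgroup I h :
  subgroup_gen
    [set eval_word w | w in [set` (reduction sub ws wt I).2]]%classic h
  <-> exists g, h = iter (index_of I) f g.
Proof.
set k := index_of I; split=> [|[g ->]].
  apply: (@subgroup_gen_min _ (fun h => exists g, h = iter k f g)).
    split=> [|_ _ [x ->] [y ->]|_ [x ->]].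
    - by exists 1%g; rewrite iter_mulg1.
    - by exists (x * y)%g; rewrite iter_mulg.
    - by exists (x^-1)%g; rewrite iter_invg.
  move=> _ [w /mapP[l _ ->] <-]; exists (val l).
  by rewrite eval_subst eval_word1.
set H := subgroup_gen _.
have [H1 HM HV] : is_subgroup H by apply: subgroup_genP.
(* The preimage of [H] under [f^k] is a subgroup, so it is enough that it contains [T]. *)
apply: (@subgroup_of_generates (fun g => H (iter k f g))) g => // [|g gT].
  split=> [|x y Hx Hy|x Hx]; first by rewrite iter_mulg1.
    by rewrite iter_mulg; apply: HM.
  by rewrite iter_invg; apply: HV.
apply: sub_subgroup_gen; exists (iter k (subst sub) [:: (true, [` gT]%fset)]).
  by apply/mapP; exists [` gT]%fset; rewrite ?mem_enum.
by rewrite eval_subst eval_word1.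
Qed.

Notation r j := (iter j f t).

Lemma reduction_satisfies alpha I h :
  satisfies_at alpha (reduction sub ws wt I).1 h <->
  [/\ alpha (h * r (tag I).*2)%g, ~~ alpha (h * r 0)%g,
      forall j, j < tag I -> alpha (h * r j.+1.*2)%g ->
        alpha (h * r j.*2)%g || alpha (h * r j.*2.+1)%g
    & forall a b s, (a, b, s) \in tagged I ->
        ~~ (alpha (h * r a.*2.+1)%g &&
            alpha (h * iter (index_of I) f (val s) * r b.*2.+1)%g)].
Proof.
have repE j : eval_word (rep sub wt j : word T) = r j.
  by rewrite /rep eval_subst wtE.
have tuple3E (a b c : literal T) : has (literal_true alpha h) [tuple a; b; c] =
    [|| alpha (h * eval_word a.2)%g == a.1, alpha (h * eval_word b.2)%g == b.1
      | alpha (h * eval_word c.2)%g == c.1].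
  by rewrite /= orbF.
have unitE b j : has (literal_true alpha h) (unit_clause sub wt b j) =
    (alpha (h * r j)%g == b).
  by rewrite tuple3E repE !orbb.
have colorE j : has (literal_true alpha h) (color_clause sub wt j) =
    (alpha (h * r j.+1.*2)%g ==>
       alpha (h * r j.*2)%g || alpha (h * r j.*2.+1)%g).
  by rewrite implybE tuple3E !repE !eqb_id eqbF_neg.
have patternE k a b s :
    has (literal_true alpha h) (pattern_clause sub ws wt k (a, b, s)) =
    ~~ (alpha (h * r a.*2.+1)%g && alpha (h * iter k f (val s) * r b.*2.+1)%g).
  rewrite negb_and tuple3E eval_word_cat !repE eval_subst wsE orbb mulgA.
  by rewrite !eqbF_neg.
have -> : satisfies_at alpha (reduction sub ws wt I).1 h =
    [&& has (literal_true alpha h) (unit_clause sub wt true (tag I).*2),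
        has (literal_true alpha h) (unit_clause sub wt false 0)
      & all (fun c : 3.-tuple _ => has (literal_true alpha h) c)
          ([seq color_clause sub wt j | j <- iota 0 (tag I)] ++
           [seq pattern_clause sub ws wt (index_of I) p
             | p <- [seq erase p | p <- tagged I]])] by [].
rewrite !unitE eqb_id eqbF_neg all_cat !all_map.
split=> [/and4P[-> -> /allP cP /allP pP]|[-> -> cP pP]].
  split=> // [j ltj|a b s abs]; last by rewrite -patternE; apply: pP abs.
  by apply/implyP; rewrite -colorE; apply: cP; rewrite mem_iota.
rewrite !andTb; apply/andP; split.
  apply/allP => j; rewrite mem_iota => ltj.
  by rewrite [preim _ _ _]colorE; apply/implyP; apply: cP.
by apply/allP => -[[a b] s] abs; rewrite [preim _ _ _]patternE; apply: pP.
Qed.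

Lemma reduction_correct I : DP I <-> kSAT (reduction sub ws wt I).
Proof.
set n := tag I; set k := index_of I; split=> [[x xP]|[alpha alphaP]].
  (* An odd offset [2a + 1] tests whether the color is [a], an even offset [2a] whether it is less
     than [a]. *)
  pose value j g := if odd j then x g == j./2 :> nat else x g < j./2.
  (* Every element outside the chosen cosets is made false; inside them [coset_rep_inj] makes the
     representation unique. *)
  pose alpha y := `[< exists j g,
    [/\ j < k, y = (iter k f g * r j)%g & value j g] >].
  have alphaE j g : j < k -> alpha (iter k f g * r j)%g = value j g.
    move=> ltjk; apply/asboolP/idP => [[i [g' [ltik E]]]|vjg]; last first.
      by exists j, g.
    by have [-> ->] := coset_rep_inj ltjk ltik E.
  have value_even j g : value j.*2 g = (x g < j).
    by rewrite /value odd_double doubleK.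
  have value_odd j g : value j.*2.+1 g = (x g == j :> nat).
    by rewrite /value /= odd_double /= uphalf_double.
  exists alpha => _ /reduction_subgroup[g ->]; apply/reduction_satisfies; split.
  - by rewrite alphaE // value_even ltn_ord.
  - by rewrite alphaE // -[0]/(0.*2) value_even.
  (* The largest offset in the clause is [2j + 2], at most [2n] and so below [k], as [alphaE]
     demands. *)
  - move=> j ltj; have ltj2 : j.*2.+2 < k by rewrite ltnS -doubleS leq_double.
    rewrite !alphaE ?value_even ?value_odd //; last 2 first.
      exact: ltnW.
      exact: ltnW (ltnW _).
    by rewrite ltnS leq_eqVlt orbC.
  - move=> a b s abs; rewrite -iter_mulg !alphaE ?ltnS ?ltn_double //.
    rewrite !value_odd; apply/negP => /andP[/eqP xa /eqP xb].
    by apply: xP abs _; exists g; split; apply: val_inj.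
have sat g : satisfies_at alpha (reduction sub ws wt I).1 (iter k f g).
  by apply: alphaP; apply/reduction_subgroup; exists g.
(* Several color variables may hold at a cell. Any selection works, because the pattern clauses
   exclude every pair of true variables with forbidden colors. *)
have /choice[x xP] g : exists a : 'I_n, alpha (iter k f g * r a.*2.+1)%g.
  have /reduction_satisfies[un u0 color _] := sat g.
  (* Descent from the true threshold [u_n]: each true [u_(j + 1)] gives a true [v_j] or [u_j], and
     [u_0] is false, so a color is met on the way. *)
  suff /(_ n (leqnn n) un) [a]: forall j, j <= n ->
      alpha (iter k f g * r j.*2)%g ->
      exists2 a, a < j & alpha (iter k f g * r a.*2.+1)%g.
    by move=> lta va; exists (Ordinal lta).
  elim=> [_ u0'|j IHj ltj /(color j ltj)/orP[/IHj[]|vj]].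
  - by rewrite u0' in u0.
  - exact: ltnW.
  - by move=> a lta va; exists a => //; apply: ltnW.
  - by exists j.
exists x => -[[a b] s] abs [g [xa xb]].
have /reduction_satisfies[_ _ _ /(_ a b s abs)] := sat g.
by rewrite -iter_mulg -xa -xb !xP.
Qed.

End GroupEmbedding.

Theorem theorem28 (G : groupType) (hG : scalable G)
    (S T : {fset G}) (hS : generates S) (hT : generates T) :
  many_one (@DP G S) (@kSAT G T 3).
Proof.
have [_ [H [_ HneqT _ [f [fH f_inj _]]]]] := hG.
have [t Ht] : exists t, ~ H t.
  by apply: contrapT => nH; apply: HneqT; apply/seteqP; split=> // t _;
    apply: contrapT => Ht; apply: nH; exists t.
have word_of := generates_word hT.
(* Words picked by choice do not endanger computability: [sub] and [ws] have finite domains, hence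
   are finite tables, and [wt] is a constant. *)
have [sub subE] := choice (fun l : bool * T => word_of (f (eval_letter l))).
have [ws wsE] := choice (fun s : S => word_of (val s)).
have [wt wtE] := word_of t.
exists (reduction sub ws wt) => [|I]; first exact: computable_reduction.
apply: (@reduction_correct G T f t) => // [|x y|g gt].
- exact: gmulfM.
- by apply: f_inj; rewrite inE.
by apply: Ht; rewrite -gt; apply: fH.
Qed.
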